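(* Let $\mathbb{T}_1,\mathbb{T}_2$ be time scales that are unbounded above, let $\alpha\in\mathbb{T}_1$, $\beta\in\mathbb{T}_2$, and consider the intervals $[\alpha,\infty)\subset\mathbb{T}_1$ and $[\beta,\infty)\subset\mathbb{T}_2$. Let $K:[\alpha,\infty)\times[\beta,\infty)\to\mathbb{R}$ be a function such that $K(x,\cdot)\in\mathcal{R}_{\mathbb{T}_2}[\beta,\infty)$ for each $x\in[\alpha,\infty)$. Suppose the following conditions are satisfied: (i) $\displaystyle\lim_{x\to x_0}\int_\beta^\infty |K(x,t)-K(x_0,t)|\,\Delta t=0$ for all $x_0\in[\alpha,\infty)$; (ii) $\displaystyle \sup_{\alpha\le x<\infty}\int_\beta^\infty |K(x,t)|\,\Delta t<\infty$; (iii) $\displaystyle\lim_{x\to\infty}\int_\beta^y |K(x,t)|\,\Delta t=0$ for all $y\in[\beta,\infty)$; (iv) $\displaystyle\lim_{x\to\infty}\int_\beta^\infty K(x,t)\,\Delta t=1$. Then the operator $L$ given by $$(Lf)(x)=\int_\beta^\infty K(x,t)f(t)\,\Delta t,\qquad x\in[\alpha,\infty),$$ belongs to $(C_{\mathbb{T}_2}[\beta,\infty),\,C_{\mathbb{T}_1}[\alpha,\infty))$. Moreover, if $f\in C_{\mathbb{T}_2}[\beta,\infty)$ and $f(t)\to s$ as $t\to\infty$, then $(Lf)(x)\to s$ as $x\to\infty$.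
   Context: A time scale $\mathbb{T}$ is a nonempty closed subset of $\mathbb{R}$, with the topology inherited from $\mathbb{R}$. All time scales are assumed unbounded above. Intervals are taken in the time scale: $[a,b]=\{t\in\mathbb{T}:a\le t\le b\}$, $[\beta,\infty)=\{t\in\mathbb{T}:t\ge\beta\}$ (with $a,b,\beta\in\mathbb{T}$), and similarly for half-open intervals. In the claim, variables $x,x_0$ range over the interval $[\alpha,\infty)$ of $\mathbb{T}_1$ and $t,y$ over the interval $[\beta,\infty)$ of $\mathbb{T}_2$. The backward jump operator is $\rho(t)=\sup\{s\in\mathbb{T}:s<t\}$. Riemann $\Delta$-integral: for $a<b$ in $\mathbb{T}$, a partition of $[a,b]$ is a finite set $P=\{t_0,\dots,t_n\}\subset[a,b]$ with $a=t_0<t_1<\dots<t_n=b$. For $\delta>0$, $\mathcal{P}_\delta(a,b)$ is the set of partitions such that for each $i\in\{1,\dots,n\}$ either $t_i-t_{i-1}\le\delta$, or $t_i-t_{i-1}>\delta$ and $\rho(t_i)=t_{i-1}$. A Riemann sum of $f$ for $P$ is $S=\sum_{i=1}^n f(\xi_i)(t_i-t_{i-1})$ with arbitrary $\xi_i\in[t_{i-1},t_i)$. The function $f$ is Riemann $\Delta$-integrable on $[a,b]$ with integral $I=\int_a^b f(t)\Delta t$ if for each $\varepsilon>0$ there is $\delta>0$ such that $|S-I|<\varepsilon$ for every Riemann sum $S$ of $f$ corresponding to any $P\in\mathcal{P}_\delta(a,b)$, independently of the choice of the $\xi_i$. The improper integral is $\int_a^\infty f(t)\Delta t=\lim_{A\to\infty,\,A\in\mathbb{T}}\int_a^A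 f(t)\Delta t$ when this limit exists and is finite. $\mathcal{R}_{\mathbb{T}}[\beta,\infty)$ is the set of real-valued functions on $[\beta,\infty)\subset\mathbb{T}$ that are Riemann $\Delta$-integrable on every bounded subinterval of $[\beta,\infty)$. $C_{\mathbb{T}}[\beta,\infty)=\{f\in\mathcal{R}_{\mathbb{T}}[\beta,\infty):\lim_{t\to\infty}f(t)\text{ exists (as a finite real number)}\}$, equipped with the norm $\|f\|=\sup_{\beta\le t<\infty}|f(t)|$. For normed spaces $X,Y$, $(X,Y)$ denotes the set of bounded linear operators from $X$ to $Y$. *)

(* Defs.v *)
From HB Require Import structures.
From mathcomp Require Import all_boot all_order all_algebra.
From mathcomp Require Import all_classical all_reals all_analysis.

Set Implicit Arguments.
Unset Strict Implicit.
Unset Printing Implicit Defensive.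

Import Order.TTheory GRing.Theory Num.Theory.
Import numFieldNormedType.Exports.

Local Open Scope classical_set_scope.
Local Open Scope ring_scope.

Section TimeScale.
Context {R : realType}.
Implicit Types (T : set R) (a b : R).

Definition time_scale T : Prop := T !=set0 /\ closed T.

Definition unbounded_above T : Prop := ~ has_ubound T.

(* [a, oo) in T.  Coerced to a type it is the domain of the functions below, so
   that they have no values outside the time scale; the type carries the
   topology induced by R. *)
Definition halfline T a : set R := [set t | T t /\ a <= t].

(* The neighbourhoods of +oo in the subspace D of R. *)
Definition at_infty (D : set R) : set_system D :=
  [set P | \forall x \near +oo, forall t : D, set_val t = x -> P t].

Arguments at_infty : clear implicits.

Global Instance at_infty_filter (D : set R) : Filter (at_infty D).
Proof.
split.
- by apply: (@nearW _ (pinfty_nbhs R)).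
- move=> P Q HP HQ.
  by apply: (@filterS2 _ (pinfty_nbhs R) _ _ _ _ _ HP HQ) => x Px Qx t tx;
    split; [exact: Px | exact: Qx].
- move=> P Q PQ HP.
  by apply: (@filterS _ (pinfty_nbhs R) _ _ _ _ HP) => x Px t tx; apply/PQ/Px.
Qed.

(* The backward jump operator; only its values at t > inf T matter below, where
   the supremum is over a nonempty bounded set. *)
Definition rho T (t : R) : R := sup [set s | T s /\ s < t].

(* t 0 < ... < t n is a partition of [a, b] in T; values t i with i > n are
   irrelevant. For a = b the only partition has n = 0. *)
Definition partition_of T a b (n : nat) (t : nat -> R) : Prop :=
  [/\ t 0%N = a, t n = b,
      forall i, (i <= n)%N -> T (t i) &
      forall i, (i < n)%N -> t i < t i.+1].

Definition delta_fine T (delta : R) (n : nat) (t : nat -> R) : Prop :=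
  forall i, (i < n)%N ->
    t i.+1 - t i <= delta \/ (t i.+1 - t i > delta /\ rho T (t i.+1) = t i).

Section Integral.
Context (T : set R) (c : R).
Implicit Types f : halfline T c -> R.

(* xi i is the sample point of the (i+1)-th cell [t i, t i.+1). *)
Definition tags (n : nat) (t : nat -> R) (xi : nat -> halfline T c) : Prop :=
  forall i, (i < n)%N -> t i <= set_val (xi i) < t i.+1.

Definition riemann_sum f (n : nat) (t : nat -> R) (xi : nat -> halfline T c)
    : R :=
  \sum_(i < n) f (xi i) * (t i.+1 - t i).

(* Meant for a <= b in [c, oo). *)
Definition is_delta_integral f a b (I : R) : Prop :=
  forall e : R, 0 < e -> exists2 delta : R, 0 < delta &
    forall (n : nat) (t : nat -> R) (xi : nat -> halfline T c),
      partition_of T a b n t -> delta_fine T delta n t -> tags n t xi ->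
      `|riemann_sum f n t xi - I| < e.

Definition delta_integrable f a b : Prop := exists I, is_delta_integral f a b I.

(* The value is 0 when f is not integrable on [a, b]. *)
Definition delta_integral f a b : R :=
  xget 0 [set I | is_delta_integral f a b I].

Definition locally_delta_integrable : set (halfline T c -> R) :=
  [set f | forall a b, halfline T c a -> halfline T c b -> a < b ->
           delta_integrable f a b].

(* Convergence of the integral of f over [c, oo) to a finite limit. *)
Definition improper_converges f : Prop :=
  (forall A, halfline T c A -> delta_integrable f c A) /\
  cvg (delta_integral f c (set_val A) @[A --> at_infty (halfline T c)]).

(* Meaningful when improper_converges f. *)
Definition improper_integral f : R :=
  lim (delta_integral f c (set_val A) @[A --> at_infty (halfline T c)]).

Definition C_space : set (halfline T c -> R) :=
  [set f | locally_delta_integrable f /\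
           exists l : R, f t @[t --> at_infty (halfline T c)] --> l].

(* Extended-real valued, so that no default value is needed for unbounded
   functions; it is finite on C_space. *)
Definition sup_norm f : \bar R :=
  ereal_sup [set (`|f t|)%:E | t in [set: halfline T c]].

End Integral.
End TimeScale.

Arguments at_infty {R} D.

(* L restricts to a bounded linear operator from the subspace X, normed by nX,
   to the subspace Y, normed by nY; values of L outside X are irrelevant. *)
Definition bounded_linear_operator (R : realType) (U V : lmodType R)
    (X : set U) (nX : U -> \bar R) (Y : set V) (nY : V -> \bar R)
    (L : U -> V) : Prop :=
  [/\ forall f, X f -> Y (L f),
      forall (k : R) f g, X f -> X g -> L (k *: f + g) = k *: L f + L g &
      exists M : R, forall f, X f -> (nY (L f) <= M%:E * nX f)%E].

(* Main.v *)
Require Import Defs.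
From mathcomp Require Import all_boot all_order all_algebra.
From mathcomp Require Import all_classical all_reals all_analysis.
From mathcomp Require Import ring lra.
Import Order.TTheory GRing.Theory Num.Theory.
Import numFieldNormedType.Exports.
Local Open Scope classical_set_scope.
Local Open Scope ring_scope.

(** The operator sends f to the integral of K(x,.) f, and everything rests on
    the estimate |int k f| <= sup|f| * int |k|.  It gives the convergence of the
    improper integrals and, with (ii), the bound on the operator norm.  Applied
    to k = K(x,.) - K(x0,.), it turns (i) into the continuity of L f at x0; a
    continuous function is Riemann integrable on bounded intervals of a closed
    time scale, so L f has the regularity that the target space asks for.  For
    the limit at infinity, write

      (L f)(x) = s * int K(x,.) + int K(x,.) (f - s).

    The first term tends to s by (iv).  In the second, pick y beyond which
    |f - s| is small: the part over [beta, y] is at most a constant times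
    int_beta^y |K(x,.)|, which vanishes by (iii), and the part beyond y is small
    uniformly in x by (ii)
    ([norm_improper_integral_tail_le], [regular_kernel_cvg]).

    These estimates need the theory of the Riemann delta-integral, above all
    that products and absolute values of integrable functions are integrable.
    It is built on an oscillation criterion: f is integrable on
    [a, b] if and only if the variation

      sum_i |f(xi_i) - f(eta_i)| (t_{i+1} - t_i)

    between two choices of tags of one partition is small for all fine
    partitions ([integrable_vanishing_variation],
    [vanishing_variation_integrable]).  This variation behaves well under
    pointwise estimates of increments ([vanishing_variation_le]), which settles
    absolute values, and products as soon as integrable functions are known to
    be bounded ([delta_integrable_bounded]).

    The existence half of the criterion compares Riemann sums over two unrelated
    partitions.  Instead of a common refinement, it uses the lengths lam_ij of
    the overlaps of the i-th cell of one with the j-th cell of the other: these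
    sum to the cell lengths in either index, so the difference of the sums is
    sum_ij lam_ij (f(xi_i) - f(eta_j)), and when lam_ij > 0 the larger of the
    two left endpoints is a point of T that lies in both cells and mediates
    between xi_i and eta_j ([riemann_sum_compare]). *)

Set Implicit Arguments.
Unset Strict Implicit.
Unset Printing Implicit Defensive.

(** * Partitions of a time scale *)

Section Partitions.
Context {R : realType} {T : set R}.
Implicit Types (a b c delta : R) (n m : nat) (t u : nat -> R).

Lemma partition_le a b n t : partition_of T a b n t ->
  forall i j, (i <= j)%N -> (j <= n)%N -> t i <= t j.
Proof.
move=> [_ _ _ tS] i; elim=> [|j IH]; first by rewrite leqn0 => /eqP ->.
rewrite leq_eqVlt => /predU1P[-> //|]; rewrite ltnS => ij jn.
exact: le_trans (IH ij (ltnW jn)) (ltW (tS _ jn)).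
Qed.

Lemma partition_bounds a b n t : partition_of T a b n t ->
  forall i, (i <= n)%N -> a <= t i <= b.
Proof.
move=> P i in_; have [t0 tn _ _] := P.
by rewrite -{1}t0 -tn !(partition_le P).
Qed.

Lemma delta_fine_le (d d' : R) n t :
  d <= d' -> delta_fine T d n t -> delta_fine T d' n t.
Proof.
move=> dd' fine i /fine[tid|[_ rhot]]; first by left; exact: le_trans dd'.
by have [|] := leP (t i.+1 - t i) d'; [left | right].
Qed.

(** Meant for u 0 = t n, so that the value at n is the same from both sides. *)
Definition cat_partition n t u : nat -> R :=
  fun i => if (i < n)%N then t i else u (i - n)%N.

Lemma cat_partition_left a b c n m t u :
  partition_of T a b n t -> partition_of T b c m u ->
  forall i, (i <= n)%N -> cat_partition n t u i = t i.
Proof.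
move=> [_ tn _ _] [u0 _ _ _] i; rewrite /cat_partition leq_eqVlt.
by move=> /predU1P[->|->//]; rewrite ltnn subnn u0.
Qed.

Lemma cat_partition_right n t u i : cat_partition n t u (n + i)%N = u i.
Proof. by rewrite /cat_partition ltnNge leq_addr /= addKn. Qed.

Lemma partition_cat a b c n m t u :
  partition_of T a b n t -> partition_of T b c m u ->
  partition_of T a c (n + m) (cat_partition n t u).
Proof.
move=> P Q; have [t0 tn tT tS] := P; have [u0 um uT uS] := Q.
have L := cat_partition_left P Q.
split; [by rewrite L|by rewrite cat_partition_right| |].
- move=> i inm; have [in_|ni] := leqP i n; first by rewrite L //; exact: tT.
  rewrite -(subnKC (ltnW ni)) cat_partition_right; apply: uT.
  by rewrite leq_subLR.
- move=> i inm; have [in_|ni] := ltnP i n; first by rewrite !L // ?tS // ltnW.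
  rewrite -(subnKC ni) -addnS !cat_partition_right; apply: uS.
  by rewrite ltn_subLR.
Qed.

Lemma delta_fine_cat a b c d n m t u :
  partition_of T a b n t -> partition_of T b c m u ->
  delta_fine T d n t -> delta_fine T d m u ->
  delta_fine T d (n + m) (cat_partition n t u).
Proof.
move=> P Q ft fu i inm; have L := cat_partition_left P Q.
have [in_|ni] := ltnP i n; first by rewrite !L // ?(ltnW in_) //; exact: ft.
rewrite -(subnKC ni) -addnS !cat_partition_right; apply: fu.
by rewrite ltn_subLR.
Qed.

Definition has_fine_partition (d a b : R) : Prop :=
  exists n t, partition_of T a b n t /\ delta_fine T d n t.

Lemma fine_partition_refl d a : T a -> has_fine_partition d a a.
Proof. by move=> Ta; exists 0%N, (fun=> a); split => //; split. Qed.

Lemma fine_partition_step d a b : T a -> T b -> a < b ->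
  b - a <= d \/ rho T b = a -> has_fine_partition d a b.
Proof.
move=> Ta Tb ab gap; exists 1%N, (fun i => if i is 0%N then a else b).
split; first by split=> // [[|i]//|[|i]//].
case=> //= _; case: gap => [|rhob]; first by left.
by have [|] := leP (b - a) d; [left | right].
Qed.

Lemma fine_partition_trans d a b c :
  has_fine_partition d a b -> has_fine_partition d b c ->
  has_fine_partition d a c.
Proof.
move=> [n [t [P ft]]] [m [u [Q fu]]]; exists (n + m)%N, (cat_partition n t u).
by split; [exact: (partition_cat P Q) | exact: (delta_fine_cat P Q)].
Qed.

Lemma closed_has_sup (A : set R) :
  closed T -> A `<=` T -> has_sup A -> T (sup A).
Proof.
move=> cT AT [A0 ubA].
by apply: cT; apply: (closureS AT); exact: closure_sup.
Qed.

Lemma closed_has_inf (A : set R) :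
  closed T -> A `<=` T -> has_inf A -> T (inf A).
Proof.
move=> cT AT infA; apply: cT => B /nbhs_ballP[e /= e0 eB].
have [x Ax xe] := inf_adherent e0 infA.
exists x; split; first exact: AT.
apply: eB; rewrite /ball /= ltr_distlC; apply/andP; split; last exact: xe.
by rewrite (lt_le_trans (y := inf A)) ?ltrBlDr ?ltrDl// ge_inf//; case: infA.
Qed.

(** Let s be the supremum of the points of [a, b] reachable from a by a fine
    partition; s belongs to T and is itself reachable.  If s < b, either T has
    points within d to the right of s, and one short step goes beyond s, or s is
    followed by a gap, and the step to its other end q, where rho q = s, is
    allowed whatever its length. *)
Lemma fine_partition_exists d a b : closed T -> 0 < d -> T a -> T b -> a <= b ->
  has_fine_partition d a b.
Proof.
move=> cT d0 Ta Tb ab.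
pose E := [set x | [/\ T x, a <= x, x <= b & has_fine_partition d a x]].
have Ea : E a by split=> //; exact: fine_partition_refl.
have supE : has_sup E by split; [exists a|exists b => x []].
set s := sup E.
have Ts : T s by apply: closed_has_sup => // x [].
have Els x : E x -> x <= s by move=> Ex; apply: ub_le_sup => //; case: supE.
have sb : s <= b by apply: ge_sup; [case: supE | move=> x []].
have as_ : a <= s by exact: Els.
have extend x y : E x -> T y -> x < y -> y <= b ->
    y - x <= d \/ rho T y = x -> E y.
  move=> [Tx ax xb hx] Ty xy yb gap; split=> //.
    by apply: le_trans ax _; exact: ltW.
  apply: fine_partition_trans hx _; exact: fine_partition_step.
have Es : E s.
  have [x Ex sdx] := sup_adherent d0 supE.
  have := Els _ Ex; rewrite le_eqVlt => /predU1P[<-//|xs].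
  by apply: (extend x) => //; left; rewrite lerBlDl -lerBlDr ltW.
have [sbe|] := eqVneq s b; first by case: Es => _ _ _; rewrite sbe.
move=> sNb; have {sNb}sltb : s < b by rewrite lt_neqAle sNb.
pose F := [set y | T y /\ s < y].
have infF : has_inf F by split; [exists b|exists s => y [_ /ltW]].
set q := inf F.
have Tq : T q by apply: closed_has_inf => // y [].
have qb : q <= b by apply: ge_inf => //; case: infF.
have sq : s <= q by apply: lb_le_inf; [case: infF | move=> y [_ /ltW]].
have noE y : E y -> s < y -> False by move=> /Els ys; rewrite ltNge ys.
(* If s < q then (s, q) misses T, hence rho T q = s. *)
move: sq; rewrite le_eqVlt => /predU1P[sq|sq]; last first.
  exfalso; apply: (noE q) => //; apply: (extend s) => //; right.
  have lb : ubound [set y | T y /\ y < q] s.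
    move=> y [Ty yq]; rewrite leNgt; apply/negP => sy; move: yq.
    by rewrite ltNge => /negP; apply; apply: ge_inf => //; case: infF.
  apply/eqP; rewrite eq_le; apply/andP; split.
    by apply: ge_sup => //; exists s.
  by apply: ub_le_sup => //; exists s.
have [y [Ty sy] yq] := inf_adherent d0 infF.
exfalso; have [yb|/ltW by_] := leP y b.
  apply: (noE y) => //; apply: (extend s) => //; left.
  by rewrite lerBlDl sq ltW.
apply: (noE b) => //; apply: (extend s) => //; left.
by rewrite lerBlDl sq (le_trans by_) // ltW.
Qed.

End Partitions.

(** * The oscillation criterion for integrability *)

Section Oscillation.
Context {R : realType} {T : set R} {c : R}.
Implicit Types (f g : halfline T c -> R) (a b d e : R) (n m : nat).
Implicit Types (t u : nat -> R) (xi eta : nat -> halfline T c).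

Lemma halfline_val (x : halfline T c) : T (set_val x) /\ c <= set_val x.
Proof. exact: set_valP x. Qed.

Lemma halfline_point (x : R) : halfline T c x ->
  {z : halfline T c | set_val z = x}.
Proof. by move=> hx; exists (SigSub (mem_set hx)). Qed.

Lemma choose_tags (z0 : halfline T c) n t (P : nat -> halfline T c -> Prop) :
  (forall i, (i < n)%N ->
     exists z : halfline T c, t i <= set_val z < t i.+1 /\ P i z) ->
  exists xi, tags n t xi /\ forall i, (i < n)%N -> P i (xi i).
Proof.
move=> H; have /choice[xi xiP] : forall i, exists z : halfline T c, (i < n)%N ->
    t i <= set_val z < t i.+1 /\ P i z.
  move=> i; have [/H[z zP]|] := ltnP i n; first by exists z.
  by exists z0.
by exists xi; split=> i /xiP[].
Qed.

Lemma partition_point a b n t i : c <= a -> partition_of T a b n t ->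
  (i <= n)%N -> halfline T c (t i).
Proof.
move=> ca P in_; have [_ _ tT _] := P; split; first exact: tT.
by have /andP[+ _] := partition_bounds P in_; exact: le_trans.
Qed.

Lemma tags_exist a b n t : halfline T c a -> partition_of T a b n t ->
  exists xi, tags n t xi.
Proof.
move=> ha P; have [z0 _] := halfline_point ha.
have [|xi [xit _]] := @choose_tags z0 n t (fun _ _ => True).
  move=> i in_.
  have [z zt] := halfline_point (partition_point ha.2 P (ltnW in_)).
  by exists z; split => //; rewrite zt lexx; case: P => _ _ _; apply.
by exists xi.
Qed.

Lemma partition_cell a b n t x : partition_of T a b n t -> a <= x < b ->
  exists2 i, (i < n)%N & t i <= x < t i.+1.
Proof.
move=> [t0 tn _ _] /andP[]; rewrite -t0 -tn => {t0 tn} t0x.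
elim: n => [|n IH]; first by rewrite ltNge t0x.
move=> xn; have [xtn|tnx] := ltP x (t n); last by exists n => //; rewrite tnx.
by have [i in_ xi] := IH xtn; exists i => //; exact: ltnW.
Qed.

(** The distance of two Riemann sums with the same partition in which no
    cancellation between cells is allowed. *)
Definition tag_variation f n t xi eta : R :=
  \sum_(i < n) `|f (xi i) - f (eta i)| * (t i.+1 - t i).

Definition vanishing_variation f a b : Prop :=
  forall e : R, 0 < e -> exists2 d : R, 0 < d &
    forall n t xi eta, partition_of T a b n t -> delta_fine T d n t ->
      tags n t xi -> tags n t eta -> tag_variation f n t xi eta <= e.

Lemma cell_length_gt0 a b n t : partition_of T a b n t ->
  forall i, (i < n)%N -> 0 < t i.+1 - t i.
Proof. by move=> [_ _ _ tS] i /tS; rewrite subr_gt0. Qed.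

(** In each cell, give the tag with the larger value to one Riemann sum and the
    other tag to a second one: the variation is then the difference of two
    Riemann sums, which are both close to the integral. *)
Lemma integrable_vanishing_variation f a b :
  delta_integrable f a b -> vanishing_variation f a b.
Proof.
move=> [I fI] e e0; have [d d0 H] := fI (e / 2) (divr_gt0 e0 (ltr0n _ 2)).
exists d => // n t xi eta P fine xit etat.
pose hi i := if f (eta i) <= f (xi i) then xi i else eta i.
pose lo i := if f (eta i) <= f (xi i) then eta i else xi i.
have hit : tags n t hi.
  by move=> i in_; rewrite /hi; case: ifP => _; [exact: xit | exact: etat].
have lot : tags n t lo.
  by move=> i in_; rewrite /lo; case: ifP => _; [exact: etat | exact: xit].
have -> : tag_variation f n t xi eta =
          riemann_sum f n t hi - riemann_sum f n t lo.
  rewrite /riemann_sum -sumrB; apply: eq_bigr => i _; rewrite -mulrBl.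
  congr (_ * _); rewrite /hi /lo; case: leP => [le|/ltW le].
    by rewrite ger0_norm // subr_ge0.
  by rewrite ler0_norm ?opprB // subr_le0.
have := H n t hi P fine hit; have := H n t lo P fine lot.
rewrite !ltr_norml; lra.
Qed.

(** The length of the intersection of the cells [t i, t i.+1) and
    [u j, u j.+1). *)
Definition overlap t u (i j : nat) : R :=
  Num.max 0 (Num.min (t i.+1) (u j.+1) - Num.max (t i) (u j)).

Lemma overlapC t u i j : overlap t u i j = overlap u t j i.
Proof. by rewrite /overlap minC [Num.max (t i) _]maxC. Qed.

Lemma sum_overlap a b n m t u :
  partition_of T a b n t -> partition_of T a b m u ->
  forall i, (i < n)%N -> \sum_(j < m) overlap t u i j = t i.+1 - t i.
Proof.
move=> P Q i in_.
(* The overlaps are the increments of the u j clamped to the i-th cell of t,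
   and their sum telescopes. *)
pose clamp x := Num.max (t i) (Num.min (t i.+1) x).
have tii : t i <= t i.+1 by case: P => _ _ _ /(_ _ in_)/ltW.
have E (j : 'I_m) : true -> overlap t u i j = clamp (u j.+1) - clamp (u j).
  move=> _; have : u j <= u j.+1 by case: Q => _ _ _ /(_ _ (ltn_ord j))/ltW.
  rewrite /overlap /clamp /Num.max /Num.min.
  by repeat case: ifP; lra.
rewrite (eq_bigr _ E).
rewrite -(big_mkord xpredT (fun j => clamp (u j.+1) - clamp (u j))).
rewrite telescope_sumr //; have [-> -> _ _] := Q.
have /andP[ati _] := partition_bounds P (ltnW in_).
have /andP[_ tib] := partition_bounds P in_.
rewrite /clamp (min_idPl tib) (max_idPr tii).
rewrite (min_idPr (le_trans ati tii)); congr (_ - _).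
by apply/max_idPl.
Qed.

(** Finitely many cells of u meet the i-th cell of t; xi' i is, among the left
    endpoints of the intersections (and xi i), the point where f is farthest
    from f (xi i).  One choice of tags thus controls all these points at
    once. *)
Lemma refining_tags f n m t u xi :
  tags n t xi ->
  exists xi', tags n t xi' /\
    forall (i j : nat) (z : halfline T c), (i < n)%N -> (j < m)%N ->
      0 < overlap t u i j -> set_val z = Num.max (t i) (u j) ->
      `|f (xi i) - f z| <= `|f (xi i) - f (xi' i)|.
Proof.
move=> xit.
pose good i k (z : halfline T c) := forall (j : nat) (w : halfline T c),
  (j < k)%N -> 0 < overlap t u i j -> set_val w = Num.max (t i) (u j) ->
  `|f (xi i) - f w| <= `|f (xi i) - f z|.
suff H i : (i < n)%N -> exists z : halfline T c,
    t i <= set_val z < t i.+1 /\ good i m z.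
  have [xi' [xi't xi'P]] := choose_tags (xi 0%N) H.
  by exists xi'; split=> // i j z in_ jm; exact: (xi'P i in_).
move=> in_; elim: m => [|k [z [zt zP]]].
  by exists (xi i); split; first exact: xit.
have [[w [wk wt wz]]|no] := pselect (exists w : halfline T c,
    [/\ 0 < overlap t u i k, set_val w = Num.max (t i) (u k) &
     `|f (xi i) - f z| <= `|f (xi i) - f w|]).
  exists w; split.
    rewrite wt le_max lexx /=; move: wk; rewrite /overlap lt_max ltxx /=.
    by rewrite subr_gt0 lt_min => /andP[].
  move=> j v; rewrite ltnS leq_eqVlt => /predU1P[->{j} _ vt|jk vk vt].
    suff -> : v = w by [].
    by apply: val_inj; move: vt; rewrite -wt.
  by apply: le_trans wz; exact: (zP j).
exists z; split=> // j v; rewrite ltnS leq_eqVlt => /predU1P[->{j} vk vt|jk].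
  by rewrite leNgt; apply/negP => /ltW lt; apply: no; exists v.
exact: (zP j).
Qed.

(** Distribute both sums over the overlaps; on a nonempty overlap go from xi i
    to eta j through the left endpoint of the overlap, and bound the two steps
    by [refining_tags]. *)
Lemma riemann_sum_compare f a b n m t u xi eta :
  halfline T c a -> partition_of T a b n t -> partition_of T a b m u ->
  tags n t xi -> tags m u eta ->
  exists xi' eta', [/\ tags n t xi', tags m u eta' &
    `|riemann_sum f n t xi - riemann_sum f m u eta| <=
       tag_variation f n t xi xi' + tag_variation f m u eta eta'].
Proof.
move=> ha P Q xit etat.
have [xi' [xi't xi'P]] := refining_tags f m u xit.
have [eta' [eta't eta'P]] := refining_tags f n t etat.
exists xi', eta'; split => //.
have -> : riemann_sum f n t xi =
    \sum_(i < n) \sum_(j < m) f (xi i) * overlap t u i j.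
  by apply: eq_bigr => i _; rewrite -mulr_sumr (sum_overlap P Q).
have -> : riemann_sum f m u eta =
    \sum_(i < n) \sum_(j < m) f (eta j) * overlap t u i j.
  rewrite exchange_big; apply: eq_bigr => j _; rewrite -mulr_sumr.
  by under eq_bigr do rewrite overlapC; rewrite (sum_overlap Q P).
have -> : tag_variation f n t xi xi' =
    \sum_(i < n) \sum_(j < m) `|f (xi i) - f (xi' i)| * overlap t u i j.
  by apply: eq_bigr => i _; rewrite -mulr_sumr (sum_overlap P Q).
have -> : tag_variation f m u eta eta' =
    \sum_(i < n) \sum_(j < m) `|f (eta j) - f (eta' j)| * overlap t u i j.
  rewrite exchange_big; apply: eq_bigr => j _; rewrite -mulr_sumr.
  by under eq_bigr do rewrite overlapC; rewrite (sum_overlap Q P).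
rewrite -sumrB -big_split /=; apply: le_trans (ler_norm_sum _ _ _) _.
apply: ler_sum => i _; rewrite -sumrB -big_split /=.
apply: le_trans (ler_norm_sum _ _ _) _.
apply: ler_sum => j _; rewrite -mulrBl -mulrDl normrM.
have ov0 : 0 <= overlap t u i j by rewrite /overlap le_max lexx.
rewrite (ger0_norm ov0); move: (ov0); rewrite le_eqVlt => /predU1P[<-|ov].
  by rewrite !mulr0.
apply: ler_wpM2r => //.
have [z zt] : {z : halfline T c | set_val z = Num.max (t i) (u j)}.
  apply: halfline_point; have ca := ha.2.
  by rewrite /Num.max; case: ifP => _;
    [exact: (partition_point ca Q (ltnW (ltn_ord j)))
    |exact: (partition_point ca P (ltnW (ltn_ord i)))].
have h1 := xi'P i j z (ltn_ord i) (ltn_ord j) ov zt.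
have h2 : `|f (eta j) - f z| <= `|f (eta j) - f (eta' j)|.
  by apply: (eta'P j i) => //; [rewrite -overlapC | rewrite maxC].
apply: le_trans (lerD h1 h2).
by rewrite [X in _ <= _ + X]distrC -{1}(subrKA (f z)); exact: ler_normD.
Qed.

(** Two fine Riemann sums are close by [riemann_sum_compare], so that they form
    a Cauchy family; its limit is the supremum of the eventual lower bounds. *)
Lemma vanishing_variation_integrable f a b : closed T ->
  halfline T c a -> halfline T c b -> a <= b ->
  vanishing_variation f a b -> delta_integrable f a b.
Proof.
move=> cT ha hb ab vf.
pose sums d : set R := [set S | exists n t xi, [/\ partition_of T a b n t,
  delta_fine T d n t, tags n t xi & S = riemann_sum f n t xi]].
have sums_ex d : 0 < d -> exists S, sums d S.
  move=> d0; have [n [t [P ft]]] := fine_partition_exists cT d0 ha.1 hb.1 ab.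
  by have [xi xit] := tags_exist ha P; exists (riemann_sum f n t xi), n, t, xi.
have cauchy e : 0 < e -> exists2 d, 0 < d &
    forall S S', sums d S -> sums d S' -> `|S - S'| <= e.
  move=> e0; have [d d0 H] := vf (e / 2) (divr_gt0 e0 (ltr0n _ 2)).
  exists d => // _ _ [n [t [xi [P ft xit ->]]]] [m [u [eta [Q fu etau ->]]]].
  have [xi' [eta' [xi't eta'u le]]] := riemann_sum_compare f ha P Q xit etau.
  have := H _ _ _ _ P ft xit xi't; have := H _ _ _ _ Q fu etau eta'u; lra.
pose low := [set x | exists2 d, 0 < d & forall S, sums d S -> x <= S].
pose I := sup low.
have key e : 0 < e -> exists2 d, 0 < d & forall S, sums d S -> `|S - I| <= e.
  move=> e0; have [d d0 H] := cauchy _ e0; exists d => // S dS.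
  have lowS : low (S - e).
    by exists d => // S' dS'; have := H S S' dS dS'; rewrite ler_norml; lra.
  have ubS : ubound low (S + e).
    move=> x [d' d'0 xS'].
    have min0 : 0 < Num.min d d' by rewrite lt_min d0.
    have [S' [n [t [xi [P ft xit S'E]]]]] := sums_ex _ min0.
    have dS' : sums d S'.
      exists n, t, xi; split=> //; apply: delta_fine_le ft.
      by rewrite ge_min lexx.
    have d'S' : sums d' S'.
      exists n, t, xi; split=> //; apply: delta_fine_le ft.
      by rewrite ge_min lexx orbT.
    have := xS' _ d'S'; have := H S S' dS dS'; rewrite ler_norml; lra.
  have h1 : S - e <= I by apply: ub_le_sup => //; exists (S + e).
  have h2 : I <= S + e by apply: ge_sup => //; exists (S - e).
  by rewrite ler_norml; lra.
exists I => e e0; have [d d0 H] := key (e / 2) (divr_gt0 e0 (ltr0n _ 2)).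
exists d => // n t xi P ft xit; apply: le_lt_trans (_ : e / 2 < e); last by lra.
by apply: H; exists n, t, xi.
Qed.

End Oscillation.

(** * The delta-integral over a bounded interval *)

Section Integral.
Context {R : realType} {T : set R} {c : R} (cT : closed T).
Implicit Types (f g h : halfline T c -> R) (a b d e : R) (n m : nat).
Implicit Types (t u : nat -> R) (xi eta : nat -> halfline T c).

(** The source of the closure properties of the integrable functions: absolute
    values and products satisfy such an estimate. *)
Lemma vanishing_variation_le f g h (A B : R) a b : 0 <= A -> 0 <= B ->
  (forall z w : halfline T c, a <= set_val z < b -> a <= set_val w < b ->
     `|h z - h w| <= A * `|f z - f w| + B * `|g z - g w|) ->
  vanishing_variation f a b -> vanishing_variation g a b ->
  vanishing_variation h a b.
Proof.
move=> A0 B0 hfg vf vg e e0; pose e' := e / (A + B + 1).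
have AB0 : 0 < A + B + 1 by lra.
have e'0 : 0 < e' by rewrite divr_gt0.
have [d d0 fd] := vf _ e'0; have [d' d'0 gd'] := vg _ e'0.
exists (Num.min d d'); first by rewrite lt_min d0.
move=> n t xi eta P ft xit etat.
have ftd : delta_fine T d n t by apply: delta_fine_le ft; rewrite ge_min lexx.
have ftd' : delta_fine T d' n t.
  by apply: delta_fine_le ft; rewrite ge_min lexx orbT.
have inside zeta i : (i < n)%N -> tags n t zeta -> a <= set_val (zeta i) < b.
  move=> in_ /(_ _ in_)/andP[l r].
  have /andP[l' _] := partition_bounds P (ltnW in_).
  have /andP[_ r'] := partition_bounds P in_.
  by rewrite (le_trans l' l) (lt_le_trans r r').
apply: (@le_trans _ _ (A * tag_variation f n t xi eta +
                       B * tag_variation g n t xi eta)).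
  rewrite !mulr_sumr -big_split /=; apply: ler_sum => i _.
  rewrite !mulrA -mulrDl; apply: ler_wpM2r.
    exact: ltW (cell_length_gt0 P (ltn_ord i)).
  by apply: hfg; apply: inside.
have : e = (A + B + 1) * e' by rewrite /e'; field; lra.
have := fd _ _ _ _ P ftd xit etat; have := gd' _ _ _ _ P ftd' xit etat.
by nra.
Qed.

(** Take a fine partition with tags xi and move the tag of a single cell to z:
    the variation is |f(xi_i) - f z| times the length of the cell and stays
    below 1, while there are only finitely many cells.  The value of f at b is
    not controlled, since no cell contains b. *)
Lemma delta_integrable_bounded f a b :
  halfline T c a -> halfline T c b -> a <= b ->
  delta_integrable f a b ->
  exists2 B : R, 0 <= B &
    forall z : halfline T c, a <= set_val z < b -> `|f z| <= B.
Proof.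
move=> ha hb ab /integrable_vanishing_variation vf.
have [d d0 H] := vf 1 ltr01.
have [n [t [P ft]]] := fine_partition_exists cT d0 ha.1 hb.1 ab.
have [xi xit] := tags_exist ha P.
pose B (i : nat) := `|f (xi i)| + (t i.+1 - t i)^-1.
have B0 (i : nat) : (i < n)%N -> 0 <= B i.
  by move=> in_; rewrite addr_ge0 // invr_ge0 ltW // (cell_length_gt0 P).
exists (\sum_(i < n) B i); first by apply: sumr_ge0 => i _; exact: B0.
move=> z zab; have [i in_ zi] := partition_cell P zab.
pose eta j := if j == i then z else xi j.
have etat : tags n t eta.
  by move=> j jn; rewrite /eta; case: eqP => [->|_] //; exact: xit.
have := H _ _ _ _ P ft xit etat.
rewrite /tag_variation (bigD1 (Ordinal in_)) //= big1 ?addr0 /eta => [|j jNi].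
  rewrite eqxx => le1; have ti0 := cell_length_gt0 P in_.
  apply: (@le_trans _ _ (B i)).
    have : `|f (xi i) - f z| <= (t i.+1 - t i)^-1.
      by rewrite -[leRHS]mul1r ler_pdivlMr.
    have := ler_normB (f (xi i)) (f (xi i) - f z); rewrite opprB addrC subrK.
    by rewrite /B; lra.
  rewrite (bigD1 (Ordinal in_)) //= lerDl; apply: sumr_ge0 => j _; exact: B0.
have -> : (j == i :> nat) = false by apply/negbTE.
by rewrite subrr normr0 mul0r.
Qed.

(** The only partition of [a, a] has no cell. *)
Lemma delta_integrable_refl f a : delta_integrable f a a.
Proof.
exists 0 => e e0; exists 1 => // n t xi [t0 tn _ tS] _ _.
case: n tn tS => [|n] tn tS.
  by rewrite /riemann_sum big_ord0 subrr normr0.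
have : t 0%N < t n.+1.
  elim: n {tn} tS => [|n IH] tS; first exact: tS.
  by apply: lt_trans (tS n.+1 (ltnSn _)); apply: IH => i /ltnW/tS.
by rewrite t0 tn ltxx.
Qed.

Lemma delta_integrable_norm f a b :
  halfline T c a -> halfline T c b -> a <= b ->
  delta_integrable f a b -> delta_integrable (fun z => `|f z|) a b.
Proof.
move=> ha hb ab /integrable_vanishing_variation vf.
apply: vanishing_variation_integrable => //.
apply: (@vanishing_variation_le f f _ 1 0) => // z w _ _.
by rewrite mul0r addr0 mul1r ler_dist_dist.
Qed.

Lemma delta_integrable_mul f g a b :
  halfline T c a -> halfline T c b -> a <= b ->
  delta_integrable f a b -> delta_integrable g a b ->
  delta_integrable (fun z => f z * g z) a b.
Proof.
move=> ha hb ab intf intg.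
have [A A0 fA] := delta_integrable_bounded ha hb ab intf.
have [B B0 gB] := delta_integrable_bounded ha hb ab intg.
apply: vanishing_variation_integrable => //.
apply: (@vanishing_variation_le f g _ B A) => //;
  [|exact: integrable_vanishing_variation..].
move=> z w zab wab.
have -> : f z * g z - f w * g w = g w * (f z - f w) + f z * (g z - g w) by ring.
apply: le_trans (ler_normD _ _) _; rewrite !normrM.
by apply: lerD; apply: ler_wpM2r => //; [exact: gB | exact: fA].
Qed.

Lemma is_delta_integral_lin f g (k : R) a b (I J : R) :
  is_delta_integral f a b I -> is_delta_integral g a b J ->
  is_delta_integral (fun z => k * f z + g z) a b (k * I + J).
Proof.
move=> fI gJ e e0; pose e' := e / (`|k| + 1).
have k0 : 0 <= `|k| by [].
have e'0 : 0 < e' by rewrite divr_gt0 //; lra.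
have [d d0 fd] := fI _ e'0; have [d' d'0 gd'] := gJ _ e'0.
exists (Num.min d d'); first by rewrite lt_min d0.
move=> n t xi P ft xit.
have {}fd := fd _ _ _ P (delta_fine_le _ ft) xit.
have {}gd' := gd' _ _ _ P (delta_fine_le _ ft) xit.
have -> : riemann_sum (fun z => k * f z + g z) n t xi - (k * I + J) =
    k * (riemann_sum f n t xi - I) + (riemann_sum g n t xi - J).
  suff -> : riemann_sum (fun z => k * f z + g z) n t xi =
      k * riemann_sum f n t xi + riemann_sum g n t xi by ring.
  rewrite mulr_sumr -big_split; apply: eq_bigr => i _ /=; ring.
apply: le_lt_trans (ler_normD _ _) _; rewrite normrM.
have : `|riemann_sum f n t xi - I| < e' by apply: fd; rewrite ge_min lexx.
have : `|riemann_sum g n t xi - J| < e' by apply: gd'; rewrite ge_min lexx orbT.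
have : e = (`|k| + 1) * e' by rewrite /e'; field; lra.
by nra.
Qed.

(** Values of integrals are related to each other through Riemann sums that are
    close to two of them simultaneously. *)
Lemma common_riemann_sum f g a b (I J e : R) :
  halfline T c a -> halfline T c b -> a <= b -> 0 < e ->
  is_delta_integral f a b I -> is_delta_integral g a b J ->
  exists n t xi, [/\ partition_of T a b n t, tags n t xi,
    `|riemann_sum f n t xi - I| < e & `|riemann_sum g n t xi - J| < e].
Proof.
move=> ha hb ab e0 fI gJ.
have [d d0 fd] := fI _ e0; have [d' d'0 gd'] := gJ _ e0.
have dd'0 : 0 < Num.min d d' by rewrite lt_min d0.
have [n [t [P ft]]] := fine_partition_exists cT dd'0 ha.1 hb.1 ab.
have [xi xit] := tags_exist ha P; exists n, t, xi; split => //.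
  by apply: fd => //; apply: delta_fine_le ft; rewrite ge_min lexx.
by apply: gd' => //; apply: delta_fine_le ft; rewrite ge_min lexx orbT.
Qed.

Lemma is_delta_integral_le f g a b (I J : R) :
  halfline T c a -> halfline T c b -> a <= b ->
  (forall z : halfline T c, a <= set_val z -> f z <= g z) ->
  is_delta_integral f a b I -> is_delta_integral g a b J -> I <= J.
Proof.
move=> ha hb ab fg fI gJ; apply/ler_addgt0Pr => e e0.
have [n [t [xi [P xit]]]] :=
  common_riemann_sum ha hb ab (divr_gt0 e0 (ltr0n _ 2)) fI gJ.
have : riemann_sum f n t xi <= riemann_sum g n t xi.
  apply: ler_sum => i _; apply: ler_wpM2r.
    exact: ltW (cell_length_gt0 P (ltn_ord i)).
  apply: fg; have /andP[l _] := xit _ (ltn_ord i).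
  have /andP[+ _] := partition_bounds P (ltnW (ltn_ord i)).
  by move=> /le_trans; apply.
rewrite !ltr_norml; lra.
Qed.

Lemma delta_integralP f a b : delta_integrable f a b ->
  is_delta_integral f a b (delta_integral f a b).
Proof. by move=> [I fI]; exact: (xgetPex 0 (ex_intro _ I fI)). Qed.

Lemma delta_integral_eq f a b (I : R) :
  halfline T c a -> halfline T c b -> a <= b ->
  is_delta_integral f a b I -> delta_integral f a b = I.
Proof.
move=> ha hb ab fI; have fJ := delta_integralP (ex_intro _ I fI).
apply/eqP; rewrite eq_le; apply/andP; split.
  exact: (is_delta_integral_le ha hb ab _ fJ fI).
exact: (is_delta_integral_le ha hb ab _ fI fJ).
Qed.

Lemma delta_integral_le f g a b : halfline T c a -> halfline T c b -> a <= b ->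
  (forall z : halfline T c, a <= set_val z -> f z <= g z) ->
  delta_integrable f a b -> delta_integrable g a b ->
  delta_integral f a b <= delta_integral g a b.
Proof.
move=> ha hb ab fg /delta_integralP fI /delta_integralP gJ.
exact: is_delta_integral_le fI gJ.
Qed.

Lemma delta_integral_lin f g (k : R) a b :
  halfline T c a -> halfline T c b -> a <= b ->
  delta_integrable f a b -> delta_integrable g a b ->
  delta_integral (fun z => k * f z + g z) a b =
  k * delta_integral f a b + delta_integral g a b.
Proof.
move=> ha hb ab /delta_integralP fI /delta_integralP gJ.
by apply: delta_integral_eq => //; exact: is_delta_integral_lin.
Qed.

(** As f is known to be integrable on [a, e], its Riemann sum over one fine
    partition that passes through b suffices to find the value. *)
Lemma delta_integral_cat f a b e : halfline T c a -> halfline T c b ->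
  halfline T c e -> a <= b -> b <= e ->
  delta_integrable f a b -> delta_integrable f b e -> delta_integrable f a e ->
  delta_integral f a e = delta_integral f a b + delta_integral f b e.
Proof.
move=> ha hb he ab be /delta_integralP fab /delta_integralP fbe.
move=> /delta_integralP fae; apply/eqP; rewrite -subr_eq0 -normr_le0.
apply/ler_addgt0Pr => eps eps0; rewrite add0r.
have eps3 : 0 < eps / 3 by rewrite divr_gt0.
have [d1 d10 H1] := fab _ eps3; have [d2 d20 H2] := fbe _ eps3.
have [d3 d30 H3] := fae _ eps3.
pose d := Num.min d1 (Num.min d2 d3).
have d0 : 0 < d by rewrite !lt_min d10 d20.
have [dd1 dd2 dd3] : [/\ d <= d1, d <= d2 & d <= d3].
  by rewrite /d !ge_min !lexx !orbT.
have [n [t [P ft]]] := fine_partition_exists cT d0 ha.1 hb.1 ab.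
have [m [u [Q fu]]] := fine_partition_exists cT d0 hb.1 he.1 be.
have [xi xit] := tags_exist ha P; have [eta etau] := tags_exist hb Q.
pose zeta i := if (i < n)%N then xi i else eta (i - n)%N.
have tleft := cat_partition_left P Q; have tright := cat_partition_right n t u.
have zt : tags (n + m) (cat_partition n t u) zeta.
  move=> i inm; have [in_|ni] := ltnP i n.
    by rewrite /zeta in_ !tleft ?(ltnW in_) //; exact: xit.
  rewrite -(subnKC ni) /zeta ltnNge leq_addr /= addKn -addnS !tright.
  apply: etau.
  by rewrite ltn_subLR.
have := H3 _ _ _ (partition_cat P Q)
  (delta_fine_le dd3 (delta_fine_cat P Q ft fu)) zt.
have := H1 _ _ _ P (delta_fine_le dd1 ft) xit.
have := H2 _ _ _ Q (delta_fine_le dd2 fu) etau.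
suff -> : riemann_sum f (n + m) (cat_partition n t u) zeta =
    riemann_sum f n t xi + riemann_sum f m u eta.
  by rewrite !ltr_norml ler_norml; lra.
rewrite /riemann_sum big_split_ord /=; congr (_ + _); apply: eq_bigr => i _.
  by rewrite /zeta !tleft ?ltn_ord // ltnW.
by rewrite -addnS !tright /zeta ltnNge leq_addr addKn.
Qed.

End Integral.

(** * Improper integrals *)

Section Improper.
Context {R : realType} {T : set R} {c : R}.
Context (cT : closed T) (ooT : unbounded_above T) (Tc : T c).
Implicit Types (f g h k : halfline T c -> R) (a b d e : R).

Lemma halfline_start : halfline T c c.
Proof. by split. Qed.

Lemma halfline_unbounded (x : R) : exists z : halfline T c, x <= set_val z.
Proof.
have [y Ty xy] : exists2 y, T y & Num.max c x < y.
  apply: contra_notP ooT => no; exists (Num.max c x) => y Ty.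
  by rewrite leNgt; apply/negP => xy; apply: no; exists y.
move: xy; rewrite gt_max => /andP[cy xy].
have [z zy] := halfline_point (conj Ty (ltW cy) : halfline T c y).
by exists z; rewrite zy ltW.
Qed.

Lemma at_infty_ge (x : R) :
  \forall z \near at_infty (halfline T c), x <= set_val z.
Proof. by exists x; split; [exact: num_real | move=> y /ltW xy z ->]. Qed.

Lemma at_inftyE (P : set (halfline T c)) :
  (\forall z \near at_infty (halfline T c), P z) ->
  exists M, forall z : halfline T c, M <= set_val z -> P z.
Proof.
move=> [M [_ HM]]; exists (M + 1) => z Mz; apply: (HM (set_val z)) => //.
by apply: lt_le_trans Mz; rewrite ltrDl.
Qed.

#[local] Instance at_infty_proper : ProperFilter (at_infty (halfline T c)).
Proof.
split; last exact: at_infty_filter.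
by move=> /at_inftyE[M HM]; have [z /HM] := halfline_unbounded M.
Qed.

Lemma locally_integrable_le f a b : locally_delta_integrable f ->
  halfline T c a -> halfline T c b -> a <= b -> delta_integrable f a b.
Proof.
move=> lf ha hb; rewrite le_eqVlt => /predU1P[->|]; last exact: lf.
exact: delta_integrable_refl.
Qed.

Lemma locally_integrable_lin f g (k : R) : locally_delta_integrable f ->
  locally_delta_integrable g ->
  locally_delta_integrable (fun z => k * f z + g z).
Proof.
move=> lf lg a b ha hb ab; have [I fI] := lf a b ha hb ab.
have [J gJ] := lg a b ha hb ab.
by exists (k * I + J); exact: is_delta_integral_lin.
Qed.

Lemma locally_integrable_norm f : locally_delta_integrable f ->
  locally_delta_integrable (fun z => `|f z|).
Proof.
by move=> lf a b ha hb ab; apply: delta_integrable_norm => //;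
  [exact: ltW | exact: lf].
Qed.

Lemma locally_integrable_mul f g : locally_delta_integrable f ->
  locally_delta_integrable g -> locally_delta_integrable (fun z => f z * g z).
Proof.
by move=> lf lg a b ha hb ab; apply: delta_integrable_mul => //;
  [exact: ltW | exact: lf | exact: lg].
Qed.

Lemma locally_integrable_cst (s : R) :
  locally_delta_integrable (fun _ : halfline T c => s).
Proof.
move=> a b ha hb ab; apply: vanishing_variation_integrable => //.
  exact: ltW.
move=> e e0; exists 1 => // n t xi eta _ _ _ _.
rewrite /tag_variation big1 ?ltW // => i _.
by rewrite subrr normr0 mul0r.
Qed.

Lemma delta_integral0 a b : halfline T c a -> halfline T c b -> a <= b ->
  delta_integral (fun _ : halfline T c => 0) a b = 0.
Proof.
move=> ha hb ab; apply: (delta_integral_eq cT ha hb ab) => e e0; exists 1 => //.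
move=> n t xi _ _ _; rewrite /riemann_sum big1 ?subrr ?normr0 // => i _.
by rewrite mul0r.
Qed.

Lemma locally_integrable_scale f (k : R) : locally_delta_integrable f ->
  locally_delta_integrable (fun z => k * f z).
Proof.
move=> lf; apply: locally_integrable_mul => //.
exact: locally_integrable_cst.
Qed.

Lemma delta_integral_scale f (k : R) a b : locally_delta_integrable f ->
  halfline T c a -> halfline T c b -> a <= b ->
  delta_integral (fun z => k * f z) a b = k * delta_integral f a b.
Proof.
move=> lf ha hb ab.
have int f' lf' := @locally_integrable_le f' _ _ lf' ha hb ab.
rewrite -[RHS]addr0 -(delta_integral0 ha hb ab) -delta_integral_lin //.
- by congr delta_integral; apply/funext => z; rewrite addr0.
- exact: int.
- exact: (int _ (locally_integrable_cst 0)).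
Qed.

Lemma delta_integral_split f a b d : locally_delta_integrable f ->
  halfline T c a -> halfline T c b -> halfline T c d -> a <= b -> b <= d ->
  delta_integral f a d = delta_integral f a b + delta_integral f b d.
Proof.
move=> lf ha hb hd ab bd; have int a' b' := @locally_integrable_le f a' b' lf.
exact: (delta_integral_cat cT ha hb hd ab bd (int _ _ ha hb ab)
  (int _ _ hb hd bd) (int _ _ ha hd (le_trans ab bd))).
Qed.

Lemma norm_delta_integral_le g h a b : locally_delta_integrable g ->
  locally_delta_integrable h ->
  (forall z : halfline T c, a <= set_val z -> `|g z| <= h z) ->
  halfline T c a -> halfline T c b -> a <= b ->
  `|delta_integral g a b| <= delta_integral h a b.
Proof.
move=> lg lh gh ha hb ab.
have ig := locally_integrable_le lg ha hb ab.
have ih := locally_integrable_le lh ha hb ab.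
have i0 := locally_integrable_le (locally_integrable_cst 0) ha hb ab.
rewrite ler_norml; apply/andP; split; last first.
  apply: delta_integral_le => // z az.
  exact: le_trans (ler_norm _) (gh z az).
rewrite -subr_ge0 opprK addrC -[delta_integral h a b]mul1r.
rewrite -(delta_integral_lin cT 1 ha hb ab ih ig).
rewrite -[leLHS](delta_integral0 ha hb ab).
apply: delta_integral_le => //.
- move=> z az; rewrite mul1r; have := gh z az; rewrite ler_norml; lra.
- by apply: (locally_integrable_le _ ha hb ab); exact: locally_integrable_lin.
Qed.

(** The Cauchy criterion: |int_z0^z g| <= int_z0^z h, which is small as soon as
    z0 is large. *)
Lemma improper_converges_le g h : locally_delta_integrable g ->
  locally_delta_integrable h -> (forall z, `|g z| <= h z) ->
  improper_converges h -> improper_converges g.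
Proof.
move=> lg lh gh [_ hcvg]; split.
  move=> A hA; exact: (locally_integrable_le lg halfline_start hA hA.2).
apply/cauchy_cvgP/cauchy_exP => e e0.
have e2 : 0 < e / 2 by rewrite divr_gt0.
have /cvgrPdist_lt/(_ _ e2) /at_inftyE[M HM] := hcvg.
have [z0 Mz0] := halfline_unbounded M.
exists (delta_integral g c (set_val z0)).
apply: filterS (at_infty_ge (set_val z0)) => z z0z; rewrite /ball /= distrC.
have [hc hz0 hz] := And3 halfline_start (halfline_val z0) (halfline_val z).
have cat k lk := @delta_integral_split k c _ _ lk hc hz0 hz hz0.2 z0z.
have le := norm_delta_integral_le lg lh (fun z _ => gh z) hz0 hz z0z.
rewrite (cat g lg) addrAC subrr add0r; apply: le_lt_trans le _.
have := HM _ Mz0; have := HM _ (le_trans Mz0 z0z).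
by rewrite (cat h lh) !ltr_norml; lra.
Qed.

Lemma improper_integral_cvg f : improper_converges f ->
  delta_integral f c (set_val A) @[A --> at_infty (halfline T c)] -->
  improper_integral f.
Proof. by case. Qed.

Lemma improper_integral_lin f g (k : R) :
  locally_delta_integrable f -> locally_delta_integrable g ->
  improper_converges f -> improper_converges g ->
  improper_converges (fun z => k * f z + g z) /\
  improper_integral (fun z => k * f z + g z) =
  k * improper_integral f + improper_integral g.
Proof.
move=> lf lg /improper_integral_cvg cf /improper_integral_cvg cg.
have cfg : delta_integral (fun z => k * f z + g z) c (set_val A)
    @[A --> at_infty (halfline T c)] -->
    k * improper_integral f + improper_integral g.
  apply: cvg_trans (cvgD (cvgM (cvg_cst k) cf) cg); apply: near_eq_cvg.
  near=> A; have hA := halfline_val A.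
  have int f' lf' := @locally_integrable_le f' c _ lf' halfline_start hA hA.2.
  by rewrite /= (delta_integral_lin _ _ halfline_start hA hA.2) //; exact: int.
split; last exact: cvg_lim cfg.
split; last by apply/cvg_ex; eexists; exact: cfg.
move=> A hA; apply: (locally_integrable_le _ halfline_start hA hA.2).
exact: locally_integrable_lin.
Unshelve. all: by end_near. Qed.

Lemma improper_converges_mul f k : locally_delta_integrable f ->
  locally_delta_integrable k -> improper_converges (fun z => `|k z|) ->
  (exists B, forall z, `|f z| <= B) ->
  improper_converges (fun z => k z * f z).
Proof.
move=> lf lk ck [B fB]; have lk' := locally_integrable_norm lk.
apply: (@improper_converges_le _ (fun z => B * `|k z|)).
- exact: locally_integrable_mul.
- exact: locally_integrable_scale.
- by move=> z; rewrite normrM mulrC ler_wpM2r.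
split.
  move=> A hA; apply: (locally_integrable_le _ halfline_start hA hA.2).
  exact: locally_integrable_scale.
apply/cvg_ex; exists (B * improper_integral (fun z => `|k z|)).
apply: cvg_trans (cvgM (cvg_cst B) (improper_integral_cvg ck)).
apply: near_eq_cvg.
near=> A; have hA := halfline_val A.
by rewrite /= (delta_integral_scale _ lk' halfline_start hA hA.2).
Unshelve. all: by end_near. Qed.

(** On [c, y] only the global bound B of f is used, and beyond y the bound e;
    the integral of |k| beyond y is at most its integral over [c, oo). *)
Lemma norm_improper_integral_tail_le f k (B e : R) (y : halfline T c) :
  locally_delta_integrable f -> locally_delta_integrable k ->
  improper_converges (fun z => `|k z|) ->
  (forall z, `|f z| <= B) ->
  (forall z, set_val y <= set_val z -> `|f z| <= e) ->
  `|improper_integral (fun z => k z * f z)| <=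
    B * delta_integral (fun z => `|k z|) c (set_val y) +
    e * improper_integral (fun z => `|k z|).
Proof.
move=> lf lk ck fB fe; have [hc hy] := (halfline_start, halfline_val y).
have lk' := locally_integrable_norm lk.
have lkf := locally_integrable_mul lk lf.
have B0 : 0 <= B by apply: le_trans (fB y).
have e0 : 0 <= e by apply: le_trans (fe y _).
have ckf : improper_converges (fun z => k z * f z).
  by apply: improper_converges_mul => //; exists B.
apply: (ler_cvg_to (cvg_norm (improper_integral_cvg ckf))
  (cvgD (cvg_cst (B * delta_integral (fun z => `|k z|) c (set_val y)))
        (cvgM (cvg_cst e) (improper_integral_cvg ck)))).
near=> A; have hA := halfline_val A.
have yA : set_val y <= set_val A by near: A; exact: at_infty_ge.
have bound a b (M : R) : halfline T c a -> halfline T c b -> a <= b -> 0 <= M ->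
    (forall z, a <= set_val z -> `|f z| <= M) ->
    `|delta_integral (fun z => k z * f z) a b| <=
      M * delta_integral (fun z => `|k z|) a b.
  move=> ha hb ab M0 fM; rewrite -(delta_integral_scale M lk' ha hb ab).
  apply: norm_delta_integral_le => //; first exact: locally_integrable_scale.
  by move=> z az; rewrite normrM mulrC ler_wpM2r // fM.
rewrite (delta_integral_split lkf hc hy hA hy.2 yA).
apply: le_trans (ler_normD _ _) _; apply: lerD.
  exact: (bound _ _ B hc hy hy.2).
apply: le_trans (bound _ _ e hy hA yA e0 fe) _; apply: ler_wpM2l => //.
rewrite (delta_integral_split lk' hc hy hA hy.2 yA) lerDr.
apply: le_trans (normr_ge0 _) (norm_delta_integral_le lk' lk' _ hc hy hy.2).
by move=> z _; rewrite normr_id.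
Unshelve. all: by end_near. Qed.

End Improper.

(** * Continuous functions, and functions with a limit at infinity *)

Section Continuous.
Context {R : realType} {T : set R} {c : R} (cT : closed T).
Implicit Types (f : halfline T c -> R) (a b d e : R).

(** Heine's theorem, from the compactness of the trace of T on [a, b].  The
    point w may lie outside [a, b]. *)
Lemma continuous_uniformly f a b e : continuous f -> 0 < e -> c <= a ->
  exists2 d : R, 0 < d & forall z w : halfline T c,
    a <= set_val z <= b -> `|set_val z - set_val w| <= d -> `|f z - f w| <= e.
Proof.
move=> cf e0 ca; pose K := `[a, b] `&` T.
have cK : compact K by apply: compact_closedI => //; exact: segment_compact.
pose P d (x : R) := forall z w : halfline T c, set_val z = x ->
  `|set_val z - set_val w| <= d -> `|f z - f w| <= e.
have : \forall d \near 0^'+, K `<=` P d.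
  apply: (proj1 (compact_near_coveringP K) cK) => x [].
  rewrite /= in_itv /= => /andP[ax xb] Tx.
  have [p px] := halfline_point (conj Tx (le_trans ca ax) : halfline T c x).
  have e2 : 0 < e / 2 by rewrite divr_gt0.
  have := cf p => /cvgrPdist_lt /(_ _ e2) /nbhs_ballP[r /= r0 pr].
  have near_p z : `|x - set_val z| < r -> `|f p - f z| < e / 2.
    by move=> zr; apply: pr; rewrite /ball /= /initial_ball /ball /= px.
  have r2 : 0 < r / 2 by rewrite divr_gt0.
  near=> x' d => z w /= zx' zw.
  have xx' : `|x - x'| < r / 2.
    by near: x'; exact: (@cvgr_dist_lt _ _ _ (nbhs x) _ id x).
  have dr : d < r / 2 by near: d; exact: nbhs_right_lt.
  have := near_p z; have := near_p w; rewrite zx' in zw *.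
  have : `|x - set_val w| < r.
    have -> : x - set_val w = (x - x') + (x' - set_val w) by ring.
    apply: le_lt_trans (ler_normD _ _) _; lra.
  have : `|x - x'| < r by lra.
  move=> /[swap] hw /[swap] /(_ hw) h1 /[swap] /[apply] h2.
  have -> : f z - f w = (f p - f w) - (f p - f z) by ring.
  apply: le_trans (ler_normB _ _) _; lra.
move=> [r /= r0 rP]; exists (r / 2); first by rewrite divr_gt0.
have r2 : 0 < r / 2 by rewrite divr_gt0.
move=> z w zab; apply: (rP (r / 2)) => //.
  by rewrite /= sub0r normrN gtr0_norm //; lra.
by split; [rewrite /= in_itv | exact: (halfline_val z).1].
Unshelve. all: by end_near. Qed.

(** The cells of a fine partition that are not short contain a single point of
    T, so that two tags in such a cell coincide; in short cells uniform
    continuity applies. *)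
Lemma continuous_locally_integrable f :
  continuous f -> locally_delta_integrable f.
Proof.
move=> cf a b ha hb ab; have le_ab := ltW ab.
apply: vanishing_variation_integrable => // e e0.
pose e' := e / (b - a).
have ba : 0 < b - a by rewrite subr_gt0.
have [d d0 unif] := @continuous_uniformly f a b e' cf (divr_gt0 e0 ba) ha.2.
exists d => // n t xi eta P ft xit etat.
have -> : e = \sum_(i < n) e' * (t i.+1 - t i).
  rewrite -mulr_sumr -(big_mkord xpredT (fun i => t i.+1 - t i)).
  rewrite telescope_sumr //; case: P => -> -> _ _.
  by rewrite /e' mulfVK // gt_eqF.
apply: ler_sum => i _; apply: ler_wpM2r.
  exact: ltW (cell_length_gt0 P (ltn_ord i)).
have /andP[xl xr] := xit _ (ltn_ord i).
have /andP[el er] := etat _ (ltn_ord i).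
have [gap|[_ rhot]] := ft _ (ltn_ord i).
  apply: unif; last by rewrite ler_norml; lra.
  have /andP[l _] := partition_bounds P (ltnW (ltn_ord i)).
  have /andP[_ r] := partition_bounds P (ltn_ord i).
  by rewrite (le_trans l xl) (le_trans (ltW xr) r).
have left_end (z : halfline T c) :
    t i <= set_val z -> set_val z < t i.+1 -> set_val z = t i.
  move=> zl zr; apply/eqP; rewrite eq_le zl andbT -rhot.
  apply: ub_le_sup; first by exists (t i.+1) => y [_ /ltW].
  exact: (conj (halfline_val z).1 zr).
have -> : xi i = eta i.
  by apply: val_inj; exact: etrans (left_end _ xl xr) (esym (left_end _ el er)).
by rewrite subrr normr0 divr_ge0 ?ltW.
Qed.

(** Near infinity f is close to its limit, and before that it is bounded as an
    integrable function on a bounded interval. *)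
Lemma C_space_bounded f : unbounded_above T -> T c -> C_space f ->
  exists B, forall z, `|f z| <= B.
Proof.
move=> ooT Tc [lf [l fl]].
have /at_inftyE[M HM] :
    \forall z \near at_infty (halfline T c), `|f z| <= `|l| + 1.
  by apply: (cvgr_norm_le _ fl); rewrite ltrDl.
have [y My] := halfline_unbounded (c := c) ooT M.
have hc := halfline_start Tc; have hy := halfline_val y.
have [B B0 fB] :=
  delta_integrable_bounded cT hc hy hy.2 (locally_integrable_le lf hc hy hy.2).
exists (B + (`|l| + 1)) => z; have hz := halfline_val z.
have l0 : 0 <= `|l| + 1 by rewrite addr_ge0.
have [zy|yz] := ltP (set_val z) (set_val y).
  by apply: le_trans (fB z _) _; rewrite ?zy ?hz.2 // lerDl.
by apply: le_trans (HM z (le_trans My yz)) _; rewrite lerDr.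
Qed.

End Continuous.

(** * Integral operators on functions with a limit at infinity *)

Section KernelOperator.
Context {R : realType} {T : set R} {c : R}.
Context (cT : closed T) (ooT : unbounded_above T) (Tc : T c).
Implicit Types (f g k : halfline T c -> R).

Lemma norm_improper_integral_le f k (B : R) :
  locally_delta_integrable f -> locally_delta_integrable k ->
  improper_converges (fun z => `|k z|) -> (forall z, `|f z| <= B) ->
  `|improper_integral (fun z => k z * f z)| <=
    B * improper_integral (fun z => `|k z|).
Proof.
move=> lf lk ck fB; have hc := halfline_start Tc.
have [y yc] := halfline_point hc.
have := norm_improper_integral_tail_le cT ooT Tc lf lk ck fB
  (fun z (_ : set_val y <= set_val z) => fB z).
have /= := delta_integral_split cT (locally_integrable_norm cT lk)
  hc hc hc (lexx c) (lexx c).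
rewrite yc => E; have -> : delta_integral (fun z => `|k z|) c c = 0 by lra.
by rewrite mulr0 add0r.
Qed.

Lemma C_space_sup_norm f : C_space f ->
  exists2 B : R, sup_norm f = B%:E & forall z, `|f z| <= B.
Proof.
move=> Cf; have [B fB] := C_space_bounded cT ooT Tc Cf.
have le z : ((`|f z|)%:E <= sup_norm f)%E by apply: ereal_sup_ubound; exists z.
have leB : (sup_norm f <= B%:E)%E.
  by apply: ge_ereal_sup => _ [z _ <-]; rewrite lee_fin.
have [z0 _] := halfline_point (halfline_start Tc).
have fin : sup_norm f \is a fin_num.
  rewrite fin_numE; apply/andP; split.
    by apply: contraTneq (le z0) => ->; rewrite leeNy_eq.
  by apply: contraTneq leB => ->; rewrite leye_eq.
exists (fine (sup_norm f)); first by rewrite fineK.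
by move=> z; rewrite -lee_fin fineK.
Qed.

Context {X : Type} {F : set_system X} {FF : Filter F}.
Context (K : X -> halfline T c -> R).
Context (lK : forall x, locally_delta_integrable (K x)).
Context (cK : forall x, improper_converges (fun t => `|K x t|)).

Lemma kernel_converges f x : C_space f ->
  improper_converges (fun t => K x t * f t).
Proof.
move=> Cf; have [B fB] := C_space_bounded cT ooT Tc Cf.
by apply: improper_converges_mul => //; [exact: Cf.1 | exists B].
Qed.

Lemma kernel_locally_integrable f x : C_space f ->
  locally_delta_integrable (fun t => K x t * f t).
Proof. by move=> [lf _]; exact: locally_integrable_mul. Qed.

Lemma kernel_L1_cvg x0 f : C_space f ->
  improper_integral (fun t => `|K x t - K x0 t|) @[x --> F] --> (0 : R) ->
  improper_integral (fun t => K x t * f t) @[x --> F] -->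
  improper_integral (fun t => K x0 t * f t).
Proof.
move=> Cf K0; have [B fB] := C_space_bounded cT ooT Tc Cf.
have lKn x := locally_integrable_norm cT (lK x).
pose D x t := K x t - K x0 t.
have DE x : D x = fun t => -1 * K x0 t + K x t.
  by apply/funext => t; rewrite /D; ring.
have lD x : locally_delta_integrable (D x).
  by rewrite DE; exact: locally_integrable_lin.
have cD x : improper_converges (fun t => `|D x t|).
  have [cKK _] := improper_integral_lin cT ooT Tc 1 (lKn x0) (lKn x)
    (cK x0) (cK x).
  apply: (improper_converges_le cT ooT Tc _ _ _ cKK).
  - exact: locally_integrable_norm.
  - exact: locally_integrable_lin.
  - by move=> t; rewrite normr_id mul1r addrC ler_normB.
have LfD x : improper_integral (fun t => K x t * f t) -
    improper_integral (fun t => K x0 t * f t) =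
    improper_integral (fun t => D x t * f t).
  have [_ E] := improper_integral_lin cT ooT Tc (-1)
    (kernel_locally_integrable x0 Cf) (kernel_locally_integrable x Cf)
    (kernel_converges x0 Cf) (kernel_converges x Cf).
  have -> : (fun t => D x t * f t) =
      (fun t => -1 * (K x0 t * f t) + K x t * f t).
    by apply/funext => t; rewrite /D; ring.
  by rewrite E; ring.
have le x : `|improper_integral (fun t => D x t * f t)| <=
    B * improper_integral (fun t => `|D x t|).
  by apply: norm_improper_integral_le => //; exact: Cf.1.
have B0 : 0 <= B.
  by have [t _] := halfline_point (halfline_start Tc); exact: le_trans (fB t).
apply/cvgrPdist_le => e e0.
(* B may vanish, hence the division by B + 1. *)
have eB : 0 < e / (B + 1) by rewrite divr_gt0 ?ltr_wpDl.
have /cvgrPdist_le/(_ _ eB) := K0; apply: filterS => x.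
rewrite sub0r normrN distrC LfD => small; apply: le_trans (le x) _.
have {}small := le_trans (ler_norm _) small.
apply: le_trans (ler_wpM2l B0 small) _.
by rewrite mulrCA ger_pMr // ler_pdivrMr ?ltr_wpDl // mul1r lerDl.
Qed.

(** The Toeplitz argument: split off the limit s of f, which is multiplied by
    int K(x,.), and cut the integral of K(x,.) (f - s) at a point beyond which
    f - s is small. *)
Lemma regular_kernel_cvg (M : R) f (s : R) : 0 < M ->
  (forall x, improper_integral (fun t => `|K x t|) <= M) ->
  (forall y, halfline T c y ->
     delta_integral (fun t => `|K x t|) c y @[x --> F] --> (0 : R)) ->
  improper_integral (K x) @[x --> F] --> (1 : R) ->
  C_space f -> f t @[t --> at_infty (halfline T c)] --> s ->
  improper_integral (fun t => K x t * f t) @[x --> F] --> s.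
Proof.
move=> M_gt0 KM K0 K1 Cf fs; have [B fB] := C_space_bounded cT ooT Tc Cf.
pose g t := - s * 1 + f t.
have lg : locally_delta_integrable g.
  apply: (locally_integrable_lin (- s) _ Cf.1); exact: locally_integrable_cst.
have gB t : `|g t| <= `|s| + B.
  by apply: le_trans (ler_normD _ _) _; rewrite mulr1 normrN lerD.
have Kcvg x : improper_converges (K x).
  exact: (improper_converges_le cT ooT Tc (lK x)
    (locally_integrable_norm cT (lK x)) (fun=> lexx _)).
have Kgcvg x : improper_converges (fun t => K x t * g t).
  by apply: improper_converges_mul => //; exists (`|s| + B).
have LfE : (fun x => improper_integral (fun t => K x t * f t)) = (fun x =>
    s * improper_integral (K x) + improper_integral (fun t => K x t * g t)).
  apply/funext => x; have [_ <-] := improper_integral_lin cT ooT Tc s (lK x)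
    (locally_integrable_mul cT (lK x) lg) (Kcvg x) (Kgcvg x).
  by congr improper_integral; apply/funext => t; rewrite /g; ring.
have Kg0 : improper_integral (fun t => K x t * g t) @[x --> F] --> (0 : R).
  apply/cvgrPdist_le => e e0.
  have e1 : 0 < e / 2 / M by rewrite !divr_gt0.
  have /cvgrPdist_le /(_ _ e1) /at_inftyE[m Hm] := fs.
  have [y my] := halfline_unbounded (c := c) ooT m.
  have gy t : set_val y <= set_val t -> `|g t| <= e / 2 / M.
    move=> yt; have := Hm t (le_trans my yt); rewrite distrC.
    by rewrite /g mulr1 addrC.
  pose B' := `|s| + B + 1.
  have B'0 : 0 < B' by have := normr_ge0 (g y); have := gB y; rewrite /B'; lra.
  have e2 : 0 < e / 2 / B' by rewrite !divr_gt0.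
  have /cvgrPdist_le /(_ _ e2) := K0 _ (halfline_val y); apply: filterS => x.
  rewrite !sub0r !normrN => small.
  apply: le_trans (norm_improper_integral_tail_le cT ooT Tc lg (lK x)
    (cK x) (B := B') _ gy) _.
    by move=> t; apply: le_trans (gB t) _; rewrite /B'; lra.
  have h1 : B' * delta_integral (fun t => `|K x t|) c (set_val y) <= e / 2.
    rewrite -ler_pdivlMl // mulrC; exact: le_trans (ler_norm _) small.
  have h2 : e / 2 / M * improper_integral (fun t => `|K x t|) <= e / 2.
    by rewrite -mulrA ger_pMr ?divr_gt0 // ler_pdivrMl // mulr1.
  lra.
rewrite LfE; have := cvgD (cvgM (cvg_cst s) K1) Kg0.
by rewrite mulr1 addr0; exact.
Qed.

End KernelOperator.

Theorem theorem8 (R : realType) (T1 T2 : set R) (alpha beta : R)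
  (K : halfline T1 alpha -> halfline T2 beta -> R)
  (L : (halfline T2 beta -> R) -> (halfline T1 alpha -> R))
  (hT1 : time_scale T1) (hT1oo : unbounded_above T1)
  (hT2 : time_scale T2) (hT2oo : unbounded_above T2)
  (halpha : T1 alpha) (hbeta : T2 beta)
  (hK : forall x, locally_delta_integrable (K x))
  (hi : forall x0 : halfline T1 alpha,
     improper_integral (fun t => `|K x t - K x0 t|) @[x --> x0] --> (0 : R))
  (hii_cvg : forall x, improper_converges (fun t => `|K x t|))
  (hii : has_ubound (range (fun x => improper_integral (fun t => `|K x t|))))
  (hiii : forall y, halfline T2 beta y ->
     delta_integral (fun t => `|K x t|) beta y
       @[x --> at_infty (halfline T1 alpha)] --> (0 : R))
  (hiv : improper_integral (K x)
       @[x --> at_infty (halfline T1 alpha)] --> (1 : R))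
  (hL : forall f x, L f x = improper_integral (fun t => K x t * f t)) :
  [/\ forall f x, C_space f -> improper_converges (fun t => K x t * f t),
      bounded_linear_operator (@C_space R T2 beta) (@sup_norm R T2 beta)
        (@C_space R T1 alpha) (@sup_norm R T1 alpha) L &
      forall f (s : R), C_space f ->
        f t @[t --> at_infty (halfline T2 beta)] --> s ->
        L f x @[x --> at_infty (halfline T1 alpha)] --> s].
Proof.
have [[_ cT1] [_ cT2]] := (hT1, hT2).
have LE f : L f = fun x => improper_integral (fun t => K x t * f t).
  by apply/funext => x; exact: hL.
(* A positive bound, so that it can be divided by. *)
have [M M_gt0 KM] : exists2 M : R, 0 < M &
    forall x, improper_integral (fun t => `|K x t|) <= M.
  have [M0 M0P] := hii; exists (`|M0| + 1); first by rewrite ltr_wpDl.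
  move=> x; have : improper_integral (fun t => `|K x t|) <= M0.
    by apply: M0P; exists x.
  by have := ler_norm M0; lra.
have KfC f x : C_space f -> improper_converges (fun t => K x t * f t).
  exact: kernel_converges.
have lKf f x : C_space f -> locally_delta_integrable (fun t => K x t * f t).
  exact: kernel_locally_integrable.
have L_cont f : C_space f -> continuous (L f).
  move=> Cf x0; rewrite LE.
  exact: (kernel_L1_cvg (FF := nbhs_filter x0) cT2 hT2oo hbeta hK hii_cvg).
have L_lim f (s : R) : C_space f ->
    f t @[t --> at_infty (halfline T2 beta)] --> s ->
    L f x @[x --> at_infty (halfline T1 alpha)] --> s.
  move=> Cf fs; rewrite LE.
  exact: (regular_kernel_cvg cT2 hT2oo hbeta hK hii_cvg M_gt0).
split => //; split.
- move=> f Cf; split; first exact: continuous_locally_integrable (L_cont f Cf).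
  by have [_ [l fl]] := Cf; exists l; exact: L_lim.
- move=> k f g Cf Cg; apply/funext => x.
  have -> : (k *: L f + L g) x = k * L f x + L g x by [].
  rewrite !hL; have [_ <-] := improper_integral_lin cT2 hT2oo hbeta k
    (lKf _ x Cf) (lKf _ x Cg) (KfC _ x Cf) (KfC _ x Cg).
  congr improper_integral; apply/funext => t.
  by have -> : (k *: f + g) t = k * f t + g t by []; ring.
- exists M => f Cf; have [B -> fB] := C_space_sup_norm cT2 hT2oo hbeta Cf.
  apply: ge_ereal_sup => _ [x _ <-]; rewrite -EFinM lee_fin hL.
  apply: le_trans (norm_improper_integral_le cT2 hT2oo hbeta Cf.1 (hK x)
    (hii_cvg x) fB) _.
  rewrite mulrC; apply: ler_wpM2r => //.
  have [z _] := halfline_point (halfline_start hbeta); exact: le_trans (fB z).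
Qed.
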